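(* Let $\boldsymbol{X}\sim \mathbb{ELS}(\boldsymbol{\lambda},\boldsymbol{\theta},\boldsymbol{\alpha};F_{b},\psi)$ and $\boldsymbol{Y}\sim \mathbb{ELS}(\boldsymbol{\mu},\boldsymbol{\delta},\boldsymbol{\beta};F_{b},\psi)$, where $\boldsymbol{\lambda}=\boldsymbol{\mu}=\lambda\boldsymbol{1}_n$ and $\boldsymbol{\theta}=\boldsymbol{\delta}=\theta\boldsymbol{1}_n$ for scalars $\lambda,\theta>0$. Suppose that either $\boldsymbol{\alpha},\boldsymbol{\beta}\in\mathcal{E}_+$ or $\boldsymbol{\alpha},\boldsymbol{\beta}\in\mathcal{D}_+$. Then $\boldsymbol{\beta}\succeq^{w}\boldsymbol{\alpha}$ implies $Y_{n-1:n}\leq_{st}X_{n-1:n}$, provided $\psi/\psi'$ is increasing.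
   Context: ''Increasing'' and ''decreasing'' are meant in the non-strict sense; a prime denotes the derivative. All random variables are nonnegative and absolutely continuous. $F_b$ is a baseline cumulative distribution function. Archimedean copulas: a $d$-monotone generator is a nonincreasing continuous $\psi:[0,\infty)\to[0,1]$ with $\psi(0)=1$, $\psi(\infty)=0$, $(-1)^i\psi^{(i)}(x)\ge0$ for $i=0,1,\dots,d-2$, and $(-1)^{d-2}\psi^{(d-2)}$ nonincreasing and convex. $\phi=\psi^{-1}$ denotes its right-continuous inverse, $\phi(v)=\sup\{x:\psi(x)>v\}$. The ($n$-dimensional) Archimedean copula with ($n$-monotone) generator $\psi$ is $C_\psi(v_1,\dots,v_n)=\psi(\phi(v_1)+\cdots+\phi(v_n))$, $v_i\in[0,1]$. $\boldsymbol{X}=(X_1,\dots,X_n)\sim\mathbb{ELS}(\boldsymbol\lambda,\boldsymbol\theta,\boldsymbol\alpha;F_b,\psi)$ (dependent exponentiated location-scale model), with $\boldsymbol\lambda,\boldsymbol\theta,\boldsymbol\alpha$ having positive entries, means that $X_i$ has distribution function $F_{X_i}(x)=[F_b((x-\lambda_i)/\theta_i)]^{\alpha_i}$ for $x>\lambda_i$ (and $0$ for $x\le\lambda_i$), $i=1,\dots,n$, and the joint distribution function of $\boldsymbol X$ is $C_\psi(F_{X_1}(x_1),\dots,F_{X_n}(x_n))$. $X_{k:n}$ is the $k$th smallest of $X_1,\dots,X_n$, so $X_{n-1:n}$ is the second-largest order statistic. $\boldsymbol 1_n=(1,\dots,1)$. $\mathcal D_+=\{(x_1,\dots,x_n):x_1\ge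 x_2\ge\cdots\ge x_n>0\}$ and $\mathcal E_+=\{(x_1,\dots,x_n):0<x_1\le x_2\le\cdots\le x_n\}$. For vectors $\boldsymbol x,\boldsymbol y$ with increasing rearrangements $x_{1:n}\le\cdots\le x_{n:n}$ and $y_{1:n}\le\cdots\le y_{n:n}$, $\boldsymbol y\succeq^w\boldsymbol x$ ($\boldsymbol x$ is weakly supermajorized by $\boldsymbol y$) means $\sum_{i=1}^k x_{i:n}\ge\sum_{i=1}^k y_{i:n}$ for all $k=1,\dots,n$. $U\le_{st}V$ means $P(U>x)\le P(V>x)$ for all $x$. *)

(* Defs.v *)
From HB Require Import structures.
From mathcomp Require Import all_boot all_order all_algebra.
From mathcomp Require Import all_classical all_reals all_analysis.

Set Implicit Arguments.
Unset Strict Implicit.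
Unset Printing Implicit Defensive.

Import Order.TTheory GRing.Theory Num.Theory.
Import numFieldNormedType.Exports.

Local Open Scope classical_set_scope.
Local Open Scope ring_scope.

(* Vectors of R^n are functions 'I_n -> R. *)

(* x_{k:n}, the k-th smallest entry of x, for 1 <= k <= n (k is 1-based). *)
Definition order_stat (R : realType) (n : nat) (k : nat) (x : 'I_n -> R) : R :=
  nth 0 (sort <=%R (codom x)) k.-1.

Definition weak_supermajorizes (R : realType) (n : nat) (y x : 'I_n -> R) : Prop :=
  forall k : nat, (1 <= k <= n)%N ->
    \sum_(1 <= i < k.+1) order_stat i y <= \sum_(1 <= i < k.+1) order_stat i x.

Definition D_plus (R : realType) (n : nat) : set ('I_n -> R) :=
  [set x | (forall i j : 'I_n, (i <= j)%N -> x j <= x i) /\ (forall i, 0 < x i)].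

Definition E_plus (R : realType) (n : nat) : set ('I_n -> R) :=
  [set x | (forall i j : 'I_n, (i <= j)%N -> x i <= x j) /\ (forall i, 0 < x i)].

(* Meaningful for 2 <= m. Only the restriction of psi to [0, +oo[ matters;
   the derivatives are taken, and the last convexity condition is imposed, on
   the open half-line, as is usual for m-monotone functions. *)
Record monotone_generator (R : realType) (m : nat) (psi : R -> R) : Prop := {
  gen_range : forall x, 0 <= x -> 0 <= psi x <= 1 ;
  gen_nonincreasing : {in `[0, +oo[ &, {homo psi : x y /~ x <= y}} ;
  gen_continuous : {within `[0, +oo[, continuous psi} ;
  gen_at0 : psi 0 = 1 ;
  gen_aty : psi x @[x --> +oo] --> (0 : R) ;
  gen_derivable : forall (i : nat) (x : R),
    (i < m - 2)%N -> 0 < x -> derivable (derive1n i psi) x 1 ;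
  gen_sign : forall (i : nat) (x : R),
    (i <= m - 2)%N -> 0 < x -> 0 <= (-1) ^+ i * derive1n i psi x ;
  gen_last_nonincreasing :
    {in `]0, +oo[ &, {homo (fun x => (-1) ^+ (m - 2) * derive1n (m - 2) psi x)
                      : x y /~ x <= y}} ;
  gen_last_convex :
    convex_function (`]0, +oo[ : set R^o)
      (fun x : R^o => (-1) ^+ (m - 2) * derive1n (m - 2) psi x : R^o)
}.

(* phi(v) = sup {x : psi(x) > v}, the supremum being taken in [0, +oo]: it is 0
   at v = 1, where the set is empty, and +oo at v = 0 when psi never vanishes. *)
Definition gen_inverse (R : realType) (psi : R -> R) (v : R) : \bar R :=
  ereal_sup (0%E |` [set x%:E | x in [set x : R | 0 <= x /\ v < psi x]]).

(* psi extended to [0, +oo] by psi(+oo) = 0. *)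
Definition gen_ext (R : realType) (psi : R -> R) (x : \bar R) : R :=
  if x is r%:E then psi r else 0.

Definition archimedean_copula (R : realType) (n : nat) (psi : R -> R)
    (v : 'I_n -> R) : R :=
  gen_ext psi (\sum_(i < n) gen_inverse psi (v i))%E.

(* The ratio psi / psi' lives on {x > 0 | psi x > 0}: a convex psi vanishing at
   infinity has psi' < 0 there, and psi' = 0 beyond the first zero of psi (at
   which psi may have a kink). *)
Definition increasing_gen_ratio (R : realType) (psi : R -> R) : Prop :=
  (forall x, 0 < x -> 0 < psi x -> derivable psi x 1) /\
  (forall x y, 0 < x -> x <= y -> 0 < psi y ->
     psi x / derive1 psi x <= psi y / derive1 psi y).

Definition els_cdf (R : realType) (Fb : R -> R) (lambda theta alpha x : R) : R :=
  if lambda < x then Fb ((x - lambda) / theta) `^ alpha else 0.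

Record ELS (R : realType) (d : measure_display) (T : measurableType d)
    (P : probability T R) (n : nat) (X : 'I_n -> {RV P >-> R})
    (lambda theta alpha : 'I_n -> R) (Fb psi : R -> R) : Prop := {
  els_lambda_gt0 : forall i, 0 < lambda i ;
  els_theta_gt0 : forall i, 0 < theta i ;
  els_alpha_gt0 : forall i, 0 < alpha i ;
  els_nonnegative : forall i, {ae P, forall w, 0 <= X i w} ;
  els_abs_continuous : forall i,
    distribution P (X i) `<< @lebesgue_measure R ;
  els_marginal : forall i (x : R),
    cdf (X i) x = (els_cdf Fb (lambda i) (theta i) (alpha i) x)%:E ;
  els_joint : forall x : 'I_n -> R,
    P [set w | forall i, X i w <= x i] =
    (archimedean_copula psi
       (fun i => els_cdf Fb (lambda i) (theta i) (alpha i) (x i)))%:E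
}.

Definition st_le (R : realType)
    (d1 : measure_display) (T1 : measurableType d1) (P : probability T1 R)
    (d2 : measure_display) (T2 : measurableType d2) (Q : probability T2 R)
    (U : T1 -> R) (V : T2 -> R) : Prop :=
  forall x : R, (P [set w | (x < U w)%R] <= Q [set w | (x < V w)%R])%E.

(* Main.v *)
Require Import Defs.
From HB Require Import structures.
From mathcomp Require Import all_boot all_order all_algebra.
From mathcomp Require Import all_classical all_reals all_analysis.
From mathcomp Require Import ring lra zify.

(** Fix x, put u = Fb ((x - lam) / th) and let phi be the inverse of psi. The
    marginals at x are the powers u^(alpha i), so that the joint distribution
    function at (x, ..., x) is psi S, where S is the sum of the
    s i = phi (u^(alpha i)); dropping the i-th variable replaces S by S - s i.
    The second largest variable is at most x when all variables but one are, and
    inclusion-exclusion gives its distribution function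

      H s = sum_i psi (S - s i) - (n - 1) psi S

    (prob_second_largest_le). The theorem states that H at alpha is at most
    H at beta, and this follows from two monotonicity properties.

    - The map a |-> phi (u^a) is increasing and concave. Indeed it inverts
      a = ln psi / ln u, and ln psi is concave since its derivative psi' / psi is
      decreasing when psi / psi' is increasing. Increasing concave maps preserve
      weak supermajorization, so the vector s built from alpha is weakly
      supermajorized by the one built from beta
      (gen_time_weak_supermajorization).

    - H is decreasing in each variable and Schur-convex, because psi is convex:
      with S fixed, H is a sum of convex functions of the s i. Hence H increases
      along weak supermajorization (second_largest_cdf_weak_majorized).

    Both properties are proved with supporting lines and summation by parts
    (abel_sum_ge), without differentiating H; in this way a kink of psi at its
    first zero is harmless. *)

Set Implicit Arguments.
Unset Strict Implicit.
Unset Printing Implicit Defensive.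

Import Order.TTheory GRing.Theory Num.Theory.
Import numFieldNormedType.Exports.

Local Open Scope classical_set_scope.
Local Open Scope ring_scope.

(** * Summation by parts and Schur-convexity *)

(** Summation by parts: the sum is a combination, with nonnegative weights
    c i - c i.+1, of the partial sums of d, plus c n times the total. Leaving
    the total on the left serves both for a nonnegative c and, when the total
    vanishes, for a c of any sign. *)
Lemma abel_sum_ge (R : realDomainType) (n : nat) (c d : nat -> R) :
  (forall i, (i < n)%N -> c i.+1 <= c i) ->
  (forall k, (k <= n)%N -> 0 <= \sum_(i < k) d i) ->
  c n * (\sum_(i < n.+1) d i) <= \sum_(i < n.+1) c i * d i.
Proof.
elim: n => [|n IH] cS dS; first by rewrite !big_ord1.
have {}IH := IH (fun i lt_in => cS i (ltnW lt_in)) (fun k le_kn => dS k (leqW le_kn)).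
rewrite big_ord_recr [leRHS]big_ord_recr /= mulrDr lerD2r.
apply: le_trans IH; apply: ler_wpM2r; [exact: dS | exact: cS].
Qed.

Lemma sum_drop_ge0 (R : numDomainType) (n k : nat) (q : nat -> R) :
  (forall i, 0 <= q i) -> (k < n)%N -> 0 <= \sum_(j < n) q j - q k.
Proof.
move=> q0 ltkn; rewrite (bigD1 (Ordinal ltkn)) //= [q k + _]addrC addrK.
by rewrite sumr_ge0.
Qed.

Lemma sum_drop_gt0 (R : numDomainType) (n k : nat) (q : nat -> R) :
  (forall i, 0 < q i) -> (k < n.+2)%N -> 0 < \sum_(j < n.+2) q j - q k.
Proof.
move=> q0 ltkn; rewrite (bigD1 (Ordinal ltkn)) //= [q k + _]addrC addrK.
have [j jk] : exists j : 'I_n.+2, j != Ordinal ltkn.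
  by exists (if k == 0%N then ord_max else ord0); case: k ltkn => [|k] ltkn.
by rewrite (bigD1 j) //= ltr_wpDr // sumr_ge0 // => i _; exact: ltW.
Qed.

(** The distribution function of the second largest of n variables whose
    dependence is the Archimedean copula generated by psi, the i-th marginal
    being psi (s i). By inclusion-exclusion it is the sum of the n probabilities
    that all variables but one are small, where the event that all of them are
    small has been counted n - 1 times too often. *)
Definition second_largest_cdf (R : realType) (n : nat) (psi : R -> R) (s : 'I_n -> R) : R :=
  \sum_(i < n) psi (\sum_(j < n) s j - s i) - n.-1%:R * psi (\sum_(j < n) s j).

Section SchurConvexity.
Variables (R : realType) (psi : R -> R).

(** Convexity in the form in which it is used: a supporting line at every
    interior point. A generator may have a kink at its first zero, so these
    lines are not all tangents. *)
Definition supported_on_half_line : Prop :=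
  forall x, 0 < x -> exists c, forall y, 0 <= y -> psi x + c * (y - x) <= psi y.

Local Notation cdf_at n p := (second_largest_cdf psi (fun i : 'I_n => p (i : nat))).

Hypothesis psi_supp : supported_on_half_line.

(** Slopes of supporting lines, chosen once for each point, increase
    automatically: add up the two inequalities satisfied at each other's
    base points. *)
Lemma supported_slopes : exists c : R -> R,
  (forall x y, 0 < x -> 0 <= y -> psi x + c x * (y - x) <= psi y) /\
  (forall x y, 0 < x -> x <= y -> c x <= c y).
Proof.
have /choice[c cP] x : exists c : R, 0 < x ->
    forall y, 0 <= y -> psi x + c * (y - x) <= psi y.
  case: (ltP 0 x) => [/psi_supp[c cP]|]; first by exists c.
  by exists 0.
exists c; split=> [x y x0 y0|x y x0 xy]; first exact: cP.
have [->//|neq_xy] := eqVneq x y.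
have {neq_xy}ltxy : 0 < y - x by rewrite subr_gt0 lt_neqAle neq_xy.
have y0 : 0 < y by exact: lt_le_trans xy.
rewrite -(ler_pM2r ltxy).
by have := lerD (cP x x0 y (ltW y0)) (cP y y0 x (ltW x0)); lra.
Qed.

Lemma supported_increments x y D :
  0 <= x -> x <= y -> 0 <= D -> psi (x + D) - psi x <= psi (y + D) - psi y.
Proof.
move=> x0; rewrite (le_eqVlt x) (le_eqVlt 0) => /predU1P[->//|xy] /predU1P[<-|D0].
  by rewrite !addr0 !subrr.
have [c [cP cM]] := supported_slopes.
(* x and y + D lie outside [m, M] at the same distance, so the two supporting
   lines, at m and at M, are evaluated at opposite displacements. *)
have Hxy m M : 0 < m -> m <= M -> m + M = x + D + y -> x <= m ->
    psi m + psi M <= psi x + psi (y + D).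
  move=> m0 mM mME xm; have M0 := lt_le_trans m0 mM.
  have H1 := cP m x m0 x0.
  have yD0 : 0 <= y + D by lra.
  have H2 := cP M _ M0 yD0.
  have := cM _ _ m0 mM; rewrite -subr_ge0 => cmM.
  have xm' : 0 <= m - x by rewrite subr_ge0.
  have := mulr_ge0 cmM xm'.
  have yDM : y + D - M = m - x by lra.
  by rewrite yDM in H2; nra.
have [le_|lt_] := leP (x + D) y.
  by have := Hxy (x + D) y; lra.
by have := Hxy y (x + D); lra.
Qed.

(** Raising the last entry by D leaves the term that omits this entry unchanged.
    By convexity, each of the other m terms moves up by at most
    psi (S + D) - psi S, and this is exactly what the correction term, with its
    coefficient m, takes away. *)
Lemma second_largest_cdf_raise_last m (q : nat -> R) D :
  (forall i, 0 <= q i) -> 0 <= D ->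
  cdf_at m.+1 (fun i => q i + D * (i == m)%:R) <= cdf_at m.+1 q.
Proof.
move=> q0 D0; rewrite /second_largest_cdf.
have -> : \sum_(j < m.+1) (q j + D * (j == m :> nat)%:R) =
          \sum_(j < m.+1) q j + D.
  rewrite big_split /=; congr (_ + _).
  rewrite big_ord_recr /= eqxx mulr1 big1 ?add0r // => i _.
  by rewrite ltn_eqF ?mulr0.
set S := \sum_(j < m.+1) q j.
rewrite big_ord_recr [in leRHS]big_ord_recr /= eqxx mulr1 opprD addrACA subrr addr0.
suff : \sum_(i < m) (psi (S + D - (q i + D * (i == m :> nat)%:R)) - psi (S - q i))
    <= m%:R * (psi (S + D) - psi S).
  rewrite sumrB mulrBr; lra.
apply: le_trans (ler_sum _ _ : _ <= \sum_(i < m) (psi (S + D) - psi S)) _.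
  move=> i _; rewrite ltn_eqF // mulr0 addr0 addrAC.
  by apply: supported_increments; rewrite ?lerBlDr ?lerDl ?sum_drop_ge0 // leqW.
by rewrite sumr_const card_ord mulr_natl.
Qed.

(** With the total S fixed, only the sum of the convex function psi (S - .) over
    the entries varies, and this is Karamata's inequality: bound each term by
    its supporting line at S - p i, then sum by parts. *)
Lemma second_largest_cdf_majorized m (p q : nat -> R) :
  (forall i, 0 < p i) -> (forall i, 0 <= q i) ->
  {homo p : i j / (i <= j)%N >-> i <= j} ->
  (forall k, (k <= m.+1)%N -> \sum_(i < k) q i <= \sum_(i < k) p i) ->
  \sum_(i < m.+2) p i = \sum_(i < m.+2) q i ->
  cdf_at m.+2 p <= cdf_at m.+2 q.
Proof.
move=> p0 q0 pM pq pqE; rewrite /second_largest_cdf -pqE lerD2r.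
set S := \sum_(i < m.+2) p i.
have [c [cP cM]] := supported_slopes.
have Sp_gt0 i : (i < m.+2)%N -> 0 < S - p i by exact: sum_drop_gt0.
have Sq_ge0 i : (i < m.+2)%N -> 0 <= S - q i by rewrite /S pqE; exact: sum_drop_ge0.
have : \sum_(i < m.+2) c (S - p i) * (p i - q i) >= 0.
  have := @abel_sum_ge R m.+1 (fun i => c (S - p i)) (fun i => p i - q i).
  rewrite sumrB pqE subrr mulr0; apply.
    move=> i lti; have lti1 : (i.+1 < m.+2)%N by [].
    apply: cM; first exact: Sp_gt0.
    by rewrite lerD2l lerN2 pM.
  by move=> k lek; rewrite sumrB subr_ge0 pq.
have : \sum_(i < m.+2) (psi (S - p i) + c (S - p i) * (p i - q i))
     <= \sum_(i < m.+2) psi (S - q i).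
  apply: ler_sum => i _; apply: le_trans (cP _ _ (Sp_gt0 i _) (Sq_ge0 i _)) => //.
  by have -> : S - q i - (S - p i) = p i - q i by lra.
rewrite big_split /=; lra.
Qed.

(** Weak supermajorization reduces to majorization by adding the missing mass D
    to the last entry of q: the partial sums of shorter length do not see it. *)
Lemma second_largest_cdf_weak_majorized m (p q : nat -> R) :
  (forall i, 0 < p i) -> (forall i, 0 <= q i) ->
  {homo p : i j / (i <= j)%N >-> i <= j} ->
  (forall k, (k <= m.+2)%N -> \sum_(i < k) q i <= \sum_(i < k) p i) ->
  cdf_at m.+2 p <= cdf_at m.+2 q.
Proof.
move=> p0 q0 pM pq.
have D0 : 0 <= \sum_(i < m.+2) p i - \sum_(i < m.+2) q i by rewrite subr_ge0 pq.
apply: le_trans (second_largest_cdf_raise_last m.+1 q0 D0).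
set D := _ - _ in D0 *.
apply: (second_largest_cdf_majorized (p := p)
  (q := fun i => q i + D * (i == m.+1)%:R)) => // [i|k lek|].
- by rewrite addr_ge0 // mulr_ge0.
- rewrite big_split /= [X in _ + X]big1 => [|i _].
    by rewrite addr0 pq // leqW.
  by rewrite ltn_eqF ?mulr0 // (leq_trans (ltn_ord i)).
- rewrite [RHS]big_split /= [X in _ + X]big_ord_recr /= eqxx mulr1 [X in _ + (X + _)]big1 => [|i _].
    by rewrite add0r addrC subrK.
  by rewrite ltn_eqF ?mulr0.
Qed.
End SchurConvexity.

(** * Convexity and inverse of a generator *)

(** The difference quotients of a convex function at x in the direction y - x
    are below f y - f x; pass to the limit from the right. *)
Lemma convex_ge_tangent (R : realType) (f : R -> R) (x y : R) :
  convex_function (`]0, +oo[ : set R^o) (f : R^o -> R^o) ->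
  0 < x -> 0 < y -> derivable f x 1 -> f x + derive1 f x * (y - x) <= f y.
Proof.
move=> cf x0 y0 dfx.
have Df : differentiable f x by exact/derivable1_diffP.
have cvgD : h^-1 *: (f (h *: (y - x) + x) - f x) @[h --> 0^'] --> derive1 f x * (y - x).
  have -> : derive1 f x * (y - x) = 'D_(y - x) f x.
    rewrite derive1E !deriveE //.
    by rewrite -[in RHS](mulr1 (y - x)) linearZ /= mulrC.
  exact: diff_derivable.
rewrite addrC -lerBrDr; apply: cvgr_to_le (cvg_dnbhs_at_right cvgD) _.
near=> h.
have h0 : 0 < h by [].
have h1 : h <= 1 by near: h; exact: nbhs_right_le.
have h01 : (0 <= h <= 1) by rewrite ltW.
have := cf (Itv01 (ltW h0) h1) y x.
rewrite !inE /= !in_itv /= x0 y0 => /(_ isT isT).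
rewrite !convRE /= => H.
have {}H : f (h * y + (1 - h) * x) <= h * f y + (1 - h) * f x by exact: H.
rewrite ler_pdivrMl //.
have <- : h * y + (1 - h) * x = h * (y - x) + x by ring.
lra.
Unshelve. all: end_near. Qed.

Lemma nondecreasing_derive_ge_tangent (R : realType) (f : R -> R) (x y : R) :
  (forall z, 0 < z -> derivable f z 1) ->
  (forall u v, 0 < u -> u <= v -> derive1 f u <= derive1 f v) ->
  0 < x -> 0 < y -> f x + derive1 f x * (y - x) <= f y.
Proof.
move=> df fM x0 y0.
have MVTf a b : 0 < a -> a <= b ->
    exists2 c, c \in `[a, b]%R & f b - f a = derive1 f c * (b - a).
  move=> a0 ab; apply: MVT_segment => //.
    move=> z /[!in_itv] /= /andP[az _].
    by rewrite derive1E; apply: DeriveDef => //; apply: df; exact: lt_trans az.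
  apply: derivable_within_continuous => z /[!in_itv] /= /andP[az _].
  by apply: df; exact: lt_le_trans az.
have [xy|/ltW yx] := leP x y.
  have [c /[!in_itv]/= /andP[xc cy] E] := MVTf _ _ x0 xy.
  rewrite -lerBrDl E; apply: ler_wpM2r; first by rewrite subr_ge0.
  exact: fM.
have [c /[!in_itv]/= /andP[yc cx] E] := MVTf _ _ y0 yx.
have : derive1 f c * (x - y) <= derive1 f x * (x - y).
  apply: ler_wpM2r; first by rewrite subr_ge0.
  by apply: fM => //; exact: lt_le_trans yc.
lra.
Qed.

Section Generator.
Variables (R : realType) (m : nat) (psi : R -> R).
Hypothesis psi_gen : monotone_generator m.+2 psi.

Let psi_range x : 0 <= x -> 0 <= psi x <= 1.
Proof. exact: gen_range psi_gen x. Qed.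

Lemma generator_nonincreasing x y : 0 <= x -> x <= y -> psi y <= psi x.
Proof.
move=> x0 xy; have y0 := le_trans x0 xy.
by apply: (gen_nonincreasing psi_gen) => //; rewrite in_itv /= andbT.
Qed.

Lemma generator_eventually_lt x e : 0 < e -> exists2 z, x < z & psi z < e.
Proof.
move=> e0.
have : \forall z \near +oo, x < z /\ psi z < e.
  near=> z; split; first by near: z; apply: nbhs_pinfty_gt; exact: num_real.
  by near: z; exact: (cvgr_lt _ (gen_aty psi_gen)).
by case/filter_ex => z [xz ze]; exists z.
Unshelve. all: end_near. Qed.

(** The hypotheses on a generator express its convexity differently in each
    dimension: directly in dimension 2, as monotonicity of psi' in dimension 3,
    as nonnegativity of psi'' from dimension 4 on. *)
Lemma generator_ge_tangent_pos x y :
  0 < x -> 0 < y -> derivable psi x 1 -> psi x + derive1 psi x * (y - x) <= psi y.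
Proof.
case: m psi_gen => [|[|k]] [_ _ _ _ _ dpsi sgn lastM lastC] x0 y0 dx.
- apply: convex_ge_tangent => // t u v u0 v0.
  by have := lastC t u v u0 v0; rewrite subnn expr0 !mul1r.
- apply: nondecreasing_derive_ge_tangent => [z z0|u v u0 uv|//|//].
    exact: (dpsi 0%N z).
  have := lastM v u; rewrite !in_itv /= u0 (lt_le_trans u0 uv) => /(_ isT isT uv).
  by rewrite expr1 !mulN1r lerN2.
- have sgn2 z : 0 < z -> 0 <= derive1 (derive1 psi) z.
    by move=> z0; have := sgn 2%N z isT z0; rewrite expr2 mulN1r opprK mul1r.
  have d2 z : 0 < z -> derivable (derive1 psi) z 1 by move=> z0; exact: (dpsi 1%N z).
  apply: nondecreasing_derive_ge_tangent => [z z0|u v u0 uv|//|//].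
    exact: (dpsi 0%N z).
  apply: (@ger0_derive1_ndecr _ (derive1 psi) u v); [| | |exact: lexx|exact: uv|exact: lexx].
  + by move=> z /[!in_itv] /= /andP[uz _]; apply: d2; exact: lt_trans uz.
  + by move=> z /[!in_itv] /= /andP[uz _]; apply: sgn2; exact: lt_trans uz.
  + apply: derivable_within_continuous => z /[!in_itv] /= /andP[uz _].
    by apply: d2; exact: lt_le_trans uz.
Qed.

Hypothesis psi_ratio : increasing_gen_ratio psi.

Let psi_derivable x : 0 < x -> 0 < psi x -> derivable psi x 1.
Proof. exact: psi_ratio.1. Qed.

(** At a horizontal tangent psi would stay above psi x > 0, against its limit
    0 at infinity. *)
Lemma generator_derive_lt0 x : 0 < x -> 0 < psi x -> derive1 psi x < 0.
Proof.
move=> x0 psix0; have [z xz psiz] := generator_eventually_lt x psix0.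
have := generator_ge_tangent_pos x0 (lt_trans x0 xz) (psi_derivable x0 psix0).
move=> /le_lt_trans /(_ psiz); rewrite -ltrBrDl subrr pmulr_llt0 // subr_gt0 //.
Qed.

(** At y = 0 the inequality comes from the bound psi <= 1 = psi 0 alone: a tangent
    starting above 1 would be above 1 at some positive point too. *)
Lemma generator_ge_tangent x y : 0 < x -> 0 < psi x -> 0 <= y ->
  psi x + derive1 psi x * (y - x) <= psi y.
Proof.
move=> x0 px0; rewrite le_eqVlt => /predU1P[<-|y0]; last first.
  exact: (generator_ge_tangent_pos x0 y0 (psi_derivable x0 px0)).
rewrite (gen_at0 psi_gen) sub0r mulrN.
set d := derive1 psi x; set K := psi x - d * x.
have d0 : d < 0 by exact: generator_derive_lt0.
rewrite leNgt; apply/negP => K1.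
(* the point where the tangent has lost half of its excess K - 1 over 1 *)
have z0 : 0 < (K - 1) / (2 * - d).
  by rewrite divr_gt0 ?mulr_gt0 ?subr_gt0 ?oppr_gt0.
have := generator_ge_tangent_pos x0 z0 (psi_derivable x0 px0).
have /andP[_] := psi_range (ltW z0).
rewrite -/d mulrBr addrCA -/K.
have -> : d * ((K - 1) / (2 * - d)) = - (K - 1) / 2 by field; rewrite lt_eqF.
lra.
Qed.

(** Tangents where psi is positive, the horizontal axis where it vanishes. *)
Lemma generator_supported : supported_on_half_line psi.
Proof.
move=> x x0; have /andP[] := psi_range (ltW x0).
rewrite le_eqVlt => /predU1P[<- _|px0 _]; last first.
  by exists (derive1 psi x) => y; exact: generator_ge_tangent.
by exists 0 => y y0; rewrite mul0r addr0; case/andP: (psi_range y0).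
Qed.

Lemma generator_decreasing x y : 0 <= x -> x < y -> 0 < psi x -> psi y < psi x.
Proof.
move=> x0 xy px0; have y0 := le_lt_trans x0 xy.
have /andP[py0 _] := psi_range (ltW y0).
have [py|py] := eqVneq (psi y) 0; first by rewrite py.
have {py0 py}py0 : 0 < psi y by rewrite lt_neqAle eq_sym py.
apply: lt_le_trans (generator_ge_tangent y0 py0 x0).
by rewrite ltrDl nmulr_rgt0 ?subr_lt0 // generator_derive_lt0.
Qed.

(** A value v > 0 is taken by continuity, and only once because psi decreases
    strictly as long as it is positive; so the supremum defining the inverse
    is finite and is the point where v is taken. *)
Lemma gen_inverse_spec v : 0 < v <= 1 ->
  exists2 s, 0 <= s & psi s = v /\ gen_inverse psi v = s%:E.
Proof.
case/andP => v0 v1; have [M M0 psiM] := generator_eventually_lt 0 v0.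
have : exists2 s, s \in `[0, M] & psi s = v.
  apply: IVT; first exact: ltW.
    by apply: continuous_subspaceW (gen_continuous psi_gen); exact: subset_itvl.
  rewrite (gen_at0 psi_gen) ge_min (ltW psiM) orbT /= le_max v1 //.
case=> s /[!in_itv] /= /andP[s0 _] psis; exists s => //; split => //.
rewrite /gen_inverse; apply/eqP; rewrite eq_le; apply/andP; split.
  apply: ge_ereal_sup => _ [->|[x [x0 vx] <-]]; first by rewrite lee_fin.
  rewrite lee_fin leNgt; apply/negP => sx.
  by have := generator_nonincreasing s0 (ltW sx); rewrite leNgt psis vx.
have [s_eq0|s_neq0] := eqVneq s 0; first by apply: ereal_sup_ubound; left; rewrite s_eq0.
have {s_neq0}s_gt0 : 0 < s by rewrite lt_neqAle eq_sym s_neq0.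
apply/lee_subgt0Pr => e e0 /=.
have [se|es] := ltP (s - e) 0.
  apply: (@le_trans _ _ 0%E); first by rewrite lee_fin ltW.
  by apply: ereal_sup_ubound; left.
have se_lt : s - e < s by lra.
apply: ereal_sup_ubound; right; exists (s - e) => //=; split => //.
rewrite -psis generator_decreasing //.
by apply: lt_le_trans (generator_nonincreasing es (ltW se_lt)); rewrite psis.
Qed.
End Generator.

(** * Log-concavity of the generator and weak supermajorization *)

Section LogTangent.
Variables (R : realType) (m : nat) (psi : R -> R).
Hypothesis psi_gen : monotone_generator m.+2 psi.
Hypothesis psi_ratio : increasing_gen_ratio psi.

Local Notation ratio x := (psi x / derive1 psi x).

Lemma gen_ratio_lt0 x : 0 < x -> 0 < psi x -> ratio x < 0.
Proof.
by move=> x0 px0; rewrite pmulr_rlt0 // invr_lt0 (generator_derive_lt0 psi_gen).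
Qed.

(** The mean value theorem for ln psi, whose derivative is the inverse of
    psi / psi'. *)
Lemma ln_generator_MVT x y : 0 < x -> x <= y -> 0 < psi y ->
  exists2 z, x <= z <= y & y - x = ratio z * (ln (psi y) - ln (psi x)).
Proof.
move=> x0 xy py0.
have pz0 z : x <= z -> z <= y -> 0 < psi z.
  move=> xz zy; apply: lt_le_trans py0 _.
  by apply: (generator_nonincreasing psi_gen) => //; exact: le_trans (ltW x0) _.
have D z : x <= z -> z <= y ->
    is_derive z 1 (@ln R \o psi) ((psi z)^-1 * derive1 psi z).
  move=> xz zy; have := pz0 z xz zy => pz.
  apply: is_derive1_comp; first exact: is_derive1_ln.
  rewrite derive1E; apply: DeriveDef => //.
  by apply: psi_ratio.1 => //; exact: lt_le_trans xz.
have [z /[!in_itv]/= /andP[xz zy] E] :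
    exists2 z, z \in `[x, y]%R &
      ln (psi y) - ln (psi x) = (psi z)^-1 * derive1 psi z * (y - x).
  apply: (@MVT_segment _ (@ln R \o psi)) => //.
    by move=> z /[!in_itv]/= /andP[/ltW xz /ltW zy]; exact: D.
  apply: derivable_within_continuous => z /[!in_itv]/= /andP[xz zy].
  exact: (@ex_derive _ _ _ _ _ _ _ (D z xz zy)).
exists z; first by rewrite xz.
have z0 := lt_le_trans x0 xz; have pz := pz0 z xz zy.
have := generator_derive_lt0 psi_gen psi_ratio z0 pz => dz.
rewrite E; field.
by rewrite (lt_eqF dz) (gt_eqF pz).
Qed.

(** The role of the monotonicity of psi / psi': it makes ln psi concave, hence
    makes the decreasing inverse of ln psi concave as well. This is the tangent
    inequality of that inverse, whose slope is psi / psi'. *)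
Lemma generator_log_tangent p q : 0 < p -> 0 < q -> 0 < psi p -> 0 < psi q ->
  q - p <= ratio p * (ln (psi q) - ln (psi p)).
Proof.
move=> p0 q0 pp0 pq0; have [pq|/ltW qp] := leP p q.
  have [z /andP[pz zq] ->] := ln_generator_MVT p0 pq pq0.
  have pz0 : 0 < psi z.
    apply: lt_le_trans pq0 _.
    by apply: (generator_nonincreasing psi_gen) => //; exact: le_trans (ltW p0) _.
  rewrite ler_wnM2r ?psi_ratio.2 // subr_le0 ler_ln //.
  by apply: (generator_nonincreasing psi_gen) => //; exact: ltW.
have [z /andP[qz zp] E] := ln_generator_MVT q0 qp pp0.
have z0 := lt_le_trans q0 qz.
have : ln (psi p) - ln (psi q) <= 0.
  rewrite subr_le0 ler_ln //.
  by apply: (generator_nonincreasing psi_gen) => //; exact: ltW.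
have := psi_ratio.2 _ _ z0 zp pp0; rewrite -[ratio z <= _]subr_ge0.
by rewrite -[q - p]opprB E; nra.
Qed.

Variable u : R.
Hypothesis u01 : 0 < u < 1.

(** The inverse generator along the powers of u: the i-th summand in the copula
    when the i-th marginal equals u to the power a. The tangent inequality
    makes it increasing and concave in a. *)
Definition gen_time (a : R) : R := fine (gen_inverse psi (u `^ a)).

Lemma gen_timeP a : 0 < a -> 0 < gen_time a /\ psi (gen_time a) = u `^ a.
Proof.
case/andP: u01 => u0 u1 a0.
have ua0 : 0 < u `^ a by exact: powR_gt0.
have ua1 : u `^ a < 1.
  have <- : 1 `^ a = 1 :> R by rewrite powR1.
  by rewrite gt0_ltr_powR // nnegrE // ltW.
have [|s s0 [ps E]] := gen_inverse_spec psi_gen psi_ratio (v := u `^ a).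
  by rewrite ua0 ltW.
rewrite /gen_time E /= ps; split=> //; rewrite lt_neqAle s0 andbT.
by apply/negP => /eqP s_eq0; move: ua1; rewrite -ps -s_eq0 (gen_at0 psi_gen) ltxx.
Qed.

Lemma gen_time_tangent a b : 0 < a -> 0 < b ->
  gen_time b - gen_time a <= ratio (gen_time a) * ln u * (b - a).
Proof.
move=> a0 b0; have [sa0 psa] := gen_timeP a0; have [sb0 psb] := gen_timeP b0.
case/andP: (u01) => u0 _.
have := generator_log_tangent sa0 sb0; rewrite psa psb !powR_gt0 // => /(_ isT isT).
by rewrite !ln_powR -mulrBl [(b - a) * _]mulrC mulrA.
Qed.

Let slope_ge0 a : 0 < a -> 0 <= ratio (gen_time a) * ln u.
Proof.
move=> a0; have [sa0 psa] := gen_timeP a0; case/andP: (u01) => u0 u1.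
rewrite mulr_le0 //; first by rewrite ltW // gen_ratio_lt0 // psa powR_gt0.
by rewrite ltW // ln_lt0 // u0.
Qed.

Lemma gen_time_nondecreasing a b : 0 < a -> a <= b -> gen_time a <= gen_time b.
Proof.
move=> a0 ab; have b0 := lt_le_trans a0 ab.
have := gen_time_tangent b0 a0; have := slope_ge0 b0.
rewrite -[a <= b]subr_ge0 in ab; nra.
Qed.

(** Increasing concave functions preserve weak supermajorization: bound the
    differences by the tangents at the a i, whose slopes are nonnegative and
    decrease with i, then sum by parts. *)
Lemma gen_time_weak_supermajorization n (a b : nat -> R) :
  (forall i, 0 < a i) -> (forall i, 0 < b i) ->
  {homo a : i j / (i <= j)%N >-> i <= j} ->
  (forall k, (k <= n)%N -> \sum_(i < k) b i <= \sum_(i < k) a i) ->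
  forall k, (k <= n)%N -> \sum_(i < k) gen_time (b i) <= \sum_(i < k) gen_time (a i).
Proof.
move=> a0 b0 aM ab [|k] lekn; first by rewrite !big_ord0.
pose c i := ratio (gen_time (a i)) * ln u.
have : c k * \sum_(i < k.+1) (a i - b i) <= \sum_(i < k.+1) c i * (a i - b i).
  apply: (@abel_sum_ge _ k c (fun i => a i - b i)) => [i lt_ik|j lejk].
    case/andP: (u01) => u0 u1.
    apply: ler_wnM2r; first by rewrite ltW // ln_lt0 // u0.
    have [sa0 psa] := gen_timeP (a0 i); have [sa0' psa'] := gen_timeP (a0 i.+1).
    apply: psi_ratio.2 => //; last by rewrite psa' powR_gt0.
    by apply: gen_time_nondecreasing => //; exact: aM.
  by rewrite sumrB subr_ge0 ab // (leq_trans lejk) // ltnW.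
have : 0 <= c k * \sum_(i < k.+1) (a i - b i).
  by rewrite mulr_ge0 ?slope_ge0 // sumrB subr_ge0 ab.
have : \sum_(i < k.+1) (gen_time (b i) - gen_time (a i)) <=
       \sum_(i < k.+1) c i * (b i - a i).
  by apply: ler_sum => i _; exact: gen_time_tangent.
have -> : \sum_(i < k.+1) c i * (b i - a i) = - \sum_(i < k.+1) c i * (a i - b i).
  by rewrite -sumrN; apply: eq_bigr => i _; rewrite -mulrN opprB.
rewrite sumrB; lra.
Qed.
End LogTangent.


(** * Increasing rearrangements *)

Section Sorting.
Variable R : realType.

(** Indexed from 0; the largest entry is repeated beyond the last index, so that
    the sequence is nondecreasing and positive everywhere. *)
Definition sorted_entry n (x : 'I_n -> R) (i : nat) : R :=
  order_stat (minn i.+1 n) x.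

Lemma sum_sorted_entry n (x : 'I_n -> R) (F : R -> R) :
  \sum_(i < n) F (sorted_entry x i) = \sum_(i < n) F (x i).
Proof.
have -> : \sum_(i < n) F (x i) = \sum_(y <- sort <=%R (codom x)) F y.
  rewrite (perm_big (codom x)) /= ?perm_sort //.
  by rewrite codomE big_map big_enum.
rewrite (big_nth 0) size_sort size_codom card_ord big_mkord.
apply: eq_bigr => i _; congr F; rewrite /sorted_entry /order_stat.
by rewrite (minn_idPl _).
Qed.

Lemma sorted_entry_nondecreasing n (x : 'I_n -> R) :
  {homo sorted_entry x : i j / (i <= j)%N >-> i <= j}.
Proof.
move=> i j le_ij; rewrite /sorted_entry /order_stat; case: n x => [|n] x.
  by rewrite !minn0.
rewrite !minnSS /=; apply: le_sorted_leq_nth => //.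
- by apply: sort_sorted; exact: le_total.
- by rewrite inE size_sort size_codom card_ord ltnS geq_minr.
- by rewrite inE size_sort size_codom card_ord ltnS geq_minr.
- by rewrite leq_min geq_minr (leq_trans (geq_minl _ _)).
Qed.

Lemma sorted_entry_gt0 n (x : 'I_n.+1 -> R) :
  (forall i, 0 < x i) -> forall i, 0 < sorted_entry x i.
Proof.
move=> x0 i; rewrite /sorted_entry /order_stat minnSS /=.
have : nth 0 (sort <=%R (codom x)) (minn i n) \in sort <=%R (codom x).
  by apply: mem_nth; rewrite size_sort size_codom card_ord ltnS geq_minr.
by rewrite mem_sort => /codomP[j ->].
Qed.

Lemma sorted_entry_weak_supermajorizes n (y x : 'I_n -> R) :
  weak_supermajorizes y x ->
  forall k, (k <= n)%N -> \sum_(i < k) sorted_entry y i <= \sum_(i < k) sorted_entry x i.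
Proof.
move=> yx [|k] lekn; first by rewrite !big_ord0.
have E z : \sum_(i < k.+1) sorted_entry z i = \sum_(1 <= i < k.+2) @order_stat R n i z.
  rewrite big_add1 big_mkord; apply: eq_bigr => i _.
  by rewrite /sorted_entry (minn_idPl _) // (leq_trans (ltn_ord i)).
by rewrite !E yx.
Qed.
End Sorting.

(** Both sides are symmetric in the parameters, which may thus be sorted. Then
    gen_time, being increasing and concave, carries the weak supermajorization
    over to the summands of the copula, along which second_largest_cdf
    increases. *)
Lemma second_largest_cdf_le (R : realType) (m : nat) (psi : R -> R) (u : R)
    (alpha beta : 'I_m.+2 -> R) :
  monotone_generator m.+2 psi -> increasing_gen_ratio psi -> 0 < u < 1 ->
  (forall i, 0 < alpha i) -> (forall i, 0 < beta i) ->
  weak_supermajorizes beta alpha ->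
  second_largest_cdf psi (gen_time psi u \o alpha) <=
  second_largest_cdf psi (gen_time psi u \o beta).
Proof.
move=> psi_gen psi_ratio u01 a0 b0 maj.
have E (x : 'I_m.+2 -> R) : second_largest_cdf psi (gen_time psi u \o x) =
    second_largest_cdf psi (fun i : 'I_m.+2 => gen_time psi u (sorted_entry x i)).
  rewrite /second_largest_cdf /=.
  rewrite (sum_sorted_entry x (gen_time psi u)).
  by rewrite (sum_sorted_entry x (fun y => psi (_ - gen_time psi u y))).
have time0 x : (forall i, 0 < x i) -> forall i, 0 < gen_time psi u (@sorted_entry R m.+2 x i).
  by move=> x0 i; have [] := gen_timeP psi_gen psi_ratio u01 (sorted_entry_gt0 x0 i).
rewrite (E alpha) (E beta); apply: (@second_largest_cdf_weak_majorized _ _ _ _ (gen_time psi u \o sorted_entry alpha)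
  (gen_time psi u \o sorted_entry beta)) => /=.
- exact: generator_supported psi_gen psi_ratio.
- exact: time0.
- by move=> i; rewrite ltW // time0.
- move=> i j lij; apply: (gen_time_nondecreasing psi_gen psi_ratio u01).
    exact: sorted_entry_gt0.
  exact: sorted_entry_nondecreasing.
- apply: (gen_time_weak_supermajorization psi_gen psi_ratio u01).
  + exact: sorted_entry_gt0.
  + exact: sorted_entry_gt0.
  + exact: sorted_entry_nondecreasing.
  + exact: sorted_entry_weak_supermajorizes.
Qed.

(** * The second largest of variables with an Archimedean copula *)

(** Both sides say that at most one entry exceeds x. *)
Lemma second_largest_leP (R : realType) (m : nat) (z : 'I_m.+2 -> R) (x : R) :
  (order_stat m.+1 z <= x) <-> (exists i, forall j, j != i -> z j <= x).
Proof.
have countE : count (<= x) (sort <=%R (codom z)) = #|[pred j | z j <= x]|.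
  rewrite (permP (permEl (perm_sort _ _))) codomE count_map enumT.
  by rewrite cardE /enum_mem size_filter; apply: eq_count.
have cardE2 : (#|[pred j | (z j <= x)%R]| + #|[pred j | (x < z j)%R]|)%N = m.+2.
  rewrite -[RHS]card_ord -(cardC [pred j | z j <= x]); congr (_ + _)%N.
  by apply: eq_card => j; rewrite !inE ltNge.
have -> : (order_stat m.+1 z <= x) = (#|[pred j | (x < z j)%R]| <= 1)%N.
  have srt : sorted <=%R (sort <=%R (codom z)) by apply: sort_sorted; exact: le_total.
  have szs : size (sort <=%R (codom z)) = m.+2 by rewrite size_sort size_codom card_ord.
  rewrite /order_stat /=; apply/idP/idP => [|le1].
    apply: contraTT; rewrite -!ltNge -ltnNge => lt1.
    by apply: nth_count_gt => //; rewrite szs countE; lia.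
  by apply: nth_count_le => //; rewrite countE; lia.
split.
  move=> /card_le1_eqP le1.
  have [/existsP[i xi]|/existsPn xn] := boolP [exists i, x < z i].
    exists i => j ji; rewrite leNgt; apply/negP => xj.
    by move/negP: ji; apply; apply/eqP; exact: (le1 i j).
  by exists ord0 => j _; rewrite leNgt xn.
case=> i zi; rewrite -(card1 i); apply: subset_leq_card; apply/fintype.subsetP => j.
by rewrite !inE ltNge; apply: contraR; exact: zi.
Qed.

Section InclusionExclusion.
Context d (T : measurableType d) (R : realType) (P : probability T R).

(** Outside of their common pairwise intersection A the events are disjoint. *)
Lemma probability_bigcup_common_intersection (n : nat) (F : 'I_n -> set T) (A : set T) :
  (0 < n)%N -> measurable A -> (forall i, measurable (F i)) ->
  (forall i, A `<=` F i) -> (forall i j, i != j -> F i `&` F j `<=` A) ->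
  fine (P (\bigcup_i F i)) = \sum_(i < n) fine (P (F i)) - n.-1%:R * fine (P A).
Proof.
move=> n0 mA mF AF FA.
have mD i : measurable (F i `\` A) by exact: measurableD.
have -> : \bigcup_i F i = A `|` \big[setU/set0]_(i < n) (F i `\` A).
  apply/seteqP; split => [w [i _ Fi]|w].
    have [Aw|nAw] := pselect (A w); first by left.
    by right; rewrite (bigD1 i) //=; left.
  case=> [Aw|]; first by exists (Ordinal n0) => //; exact: AF.
  by elim/big_ind : _ => [//|U V HU HV []//|i _ [Fi _]]; exists i.
rewrite measureU //; last 2 first.
- exact: bigsetU_measurable.
- apply/seteqP; split => // w [Aw]; elim/big_ind : _ => [//|U V HU HV []//|i _ [_]//].
rewrite measure_bigsetU_ord //; last first.
  apply/trivIsetP => i j _ _ ij; apply/seteqP; split => // w [[Fi nA] [Fj _]].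
  by apply: nA; apply: FA ij _ _.
rewrite fineD ?fin_num_measure //; last first.
  by apply/sum_fin_numP => i _ _; rewrite fin_num_measure.
rewrite -sum_fine => [|i _]; last by rewrite fin_num_measure.
rewrite (eq_bigr (fun i => fine (P (F i)) - fine (P A))) => [|i _]; last first.
  rewrite measureD //; last by rewrite ltey_eq fin_num_measure.
  by rewrite setIidr // fineB // fin_num_measure.
rewrite sumrB sumr_const card_ord -[_ *+ n]mulr_natl.
have -> : n%:R = n.-1%:R + 1 :> R by rewrite natr1 prednK.
by ring.
Qed.
End InclusionExclusion.

Section Copula.
Context d (T : measurableType d) (R : realType) (P : probability T R).
Variables (m : nat) (psi : R -> R) (X : 'I_m.+2 -> {RV P >-> R}) (F : 'I_m.+2 -> R -> R).
Hypothesis psi_gen : monotone_generator m.+2 psi.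
Hypothesis psi_ratio : increasing_gen_ratio psi.
Hypothesis XF : forall i y, cdf (X i) y = (F i y)%:E.
Hypothesis XC : forall y : 'I_m.+2 -> R,
  P [set w | forall i, X i w <= y i] =
  (archimedean_copula psi (fun i => F i (y i)))%:E.

Local Notation phi v := (fine (gen_inverse psi v)).

Lemma phiP v : 0 < v <= 1 -> 0 <= phi v /\ psi (phi v) = v.
Proof. by case/(gen_inverse_spec psi_gen psi_ratio) => s s0 [ps ->] /=. Qed.

(** For positive arguments, every value of the inverse generator is finite, so
    that no infinite sum has to be extended by psi(+oo) = 0. *)
Lemma archimedean_copula_fin (v : 'I_m.+2 -> R) : (forall i, 0 < v i <= 1) ->
  archimedean_copula psi v = psi (\sum_i phi (v i)).
Proof.
move=> v01; rewrite /archimedean_copula.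
rewrite (eq_bigr (fun i => (phi (v i))%:E)) ?sumEFin // => i _.
by have [s _ [_ ->]] := gen_inverse_spec psi_gen psi_ratio (v01 i).
Qed.

Lemma cdf_prob i y : P [set w | X i w <= y] = (F i y)%:E.
Proof.
by rewrite -XF /cdf /distribution /pushforward; congr (P _).
Qed.

Lemma measurable_le i y : measurable [set w | X i w <= y].
Proof.
have -> : [set w | X i w <= y] = X i @^-1` `]-oo, y].
  by apply/seteqP; split=> w /=; rewrite in_itv.
by rewrite -[X in measurable X]setTI; exact: measurable_funP.
Qed.

Lemma measurable_all_le (p : pred 'I_m.+2) (y : 'I_m.+2 -> R) :
  measurable [set w | forall i, p i -> X i w <= y i].
Proof.
have -> : [set w | forall i, p i -> X i w <= y i] =
          \bigcap_(i in [set i | p i]) [set w | X i w <= y i].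
  by apply/seteqP; split=> w H i; exact: H.
by apply: fin_bigcap_measurable => // i _; exact: measurable_le.
Qed.

Lemma second_largest_le_bigcup x :
  [set w | order_stat m.+1 (fun i => X i w) <= x] =
  \bigcup_i [set w | forall j, j != i -> X j w <= x].
Proof.
apply/seteqP; split => w /= => [/second_largest_leP[i H]|[i _ H]]; first by exists i.
by apply/second_largest_leP; exists i.
Qed.

Lemma measurable_second_largest_le x :
  measurable [set w | order_stat m.+1 (fun i => X i w) <= x].
Proof.
rewrite second_largest_le_bigcup; apply: fin_bigcup_measurable => [|i _].
  exact: finite_finset.
exact: measurable_all_le.
Qed.

(** If no more than one variable exceeds x, the first or the last one does not. *)
Lemma prob_second_largest_le_eq0 x : (forall i, F i x = 0) ->
  P [set w | order_stat m.+1 (fun i => X i w) <= x] = 0%E.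
Proof.
move=> Fx0; apply/eqP; rewrite eq_le measure_ge0 andbT.
pose A i := [set w | X i w <= x].
have mA i : measurable (A i) by exact: measurable_le.
have PA0 i : P (A i) = 0%E by rewrite cdf_prob Fx0.
have PU : (P (A ord0 `|` A ord_max) <= P (A ord0) + P (A ord_max))%E.
  exact: measureU2.
rewrite !PA0 adde0 in PU; apply: le_trans PU; apply: le_measure; rewrite ?inE.
- exact: measurable_second_largest_le.
- exact: measurableU.
- rewrite second_largest_le_bigcup => w [i _ H].
  have [i0|i0] := eqVneq i ord0; last by left; apply: H; rewrite eq_sym.
  by right; apply: H; rewrite i0.
Qed.

Lemma F_le1 i y : F i y <= 1.
Proof. by rewrite -lee_fin -XF; exact: cdf_le1. Qed.

Lemma F_nondecreasing i y z : y <= z -> F i y <= F i z.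
Proof. by move=> yz; rewrite -lee_fin -!XF; exact: cdf_nondecreasing. Qed.

Lemma F_near1 i e x : 0 < e -> exists2 k, x <= k & 1 - F i k <= e.
Proof.
move=> e0; have /fine_cvgP[_ cv] := @cvg_cdfy1 _ _ _ _ (X i).
have : \forall k \near +oo, x <= k /\ 1 - F i k <= e.
  near=> k; split; first by near: k; apply: nbhs_pinfty_ge; exact: num_real.
  suff : 1 - e < F i k by lra.
  have -> : F i k = fine (cdf (X i) k) by rewrite XF.
  by near: k; apply: (cvgr_gt _ cv) => /=; rewrite ltrBlDr ltrDl.
by case/filter_ex => k [xk ek]; exists k.
Unshelve. all: end_near. Qed.

Variable x : R.
Hypothesis Fx0 : forall i, 0 < F i x.

Local Notation s := (fun i => phi (F i x)).

Lemma prob_all_le : fine (P [set w | forall i, X i w <= x]) = psi (\sum_i s i).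
Proof.
rewrite (XC (fun=> x)) /= archimedean_copula_fin // => i.
by rewrite Fx0 F_le1.
Qed.

(** This marginal of the copula is obtained by letting the i-th threshold k go to
    infinity. Both sides differ from the joint distribution function with
    threshold k by at most the probability 1 - F i k that the i-th variable
    exceeds k: the left side by a union bound, the right side because the
    increments of a convex psi are smallest in absolute value far from 0, so
    that psi loses at most psi 0 - psi t between S and S + t. *)
Lemma prob_all_but_one_le i :
  fine (P [set w | forall j, j != i -> X j w <= x]) = psi (\sum_j s j - s i).
Proof.
have s0 j : 0 <= s j by have [] := @phiP (F j x); rewrite ?Fx0 ?F_le1.
set S := \sum_j s j - s i.
have S0 : 0 <= S by rewrite /S (bigD1 i) //= [s i + _]addrC addrK sumr_ge0.
have mA := measurable_all_le (fun j => j != i) (fun=> x).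
set A := [set w | _] in mA *.
suff close k : x <= k -> `|fine (P A) - psi S| <= 1 - F i k.
  apply/eqP; rewrite -subr_eq0 -normr_le0; apply/ler_addgt0Pl => e e0.
  have [k xk ek] := F_near1 i x e0.
  by rewrite addr0; exact: le_trans (close k xk) ek.
move=> xk; pose y j := if j == i then k else x.
have Fik : 0 < F i k <= 1 by rewrite (lt_le_trans (Fx0 i)) ?F_le1 // F_nondecreasing.
have [t0 psit] := phiP Fik; set t := phi (F i k) in t0 psit.
have mB : measurable [set w | forall j, X j w <= y j].
  have := measurable_all_le predT y; congr (measurable _).
  by apply/seteqP; split=> w H j => [|_]; exact: H.
have PB : P [set w | forall j, X j w <= y j] = (psi (S + t))%:E.
  rewrite XC archimedean_copula_fin => [|j].
    rewrite (bigD1 i) //= /y eqxx /S (bigD1 i (F := s)) //= [s i + _]addrC addrK addrC.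
    congr (psi (_ + _))%:E; apply: eq_bigr => j /negPf ji; by rewrite ji.
  rewrite F_le1 andbT (lt_le_trans (Fx0 j)) // F_nondecreasing // /y.
  by case: eqP.
set B := [set w | _] in mB PB.
have BA : B `<=` A by move=> w Bw j /negPf ji; have := Bw j; rewrite /y ji.
have AB : A `<=` B `|` ~` [set w | X i w <= k].
  move=> w Aw; have [le_k|gt_k] := pselect (X i w <= k); last by right.
  by left=> j; rewrite /y; case: eqP => [->//|/eqP ji]; apply: Aw.
have mXk := measurable_le i k.
have le1 : psi (S + t) <= fine (P A).
  rewrite -lee_fin fineK ?fin_num_measure // -PB.
  by apply: le_measure; rewrite ?inE.
have le2 : fine (P A) <= psi (S + t) + (1 - F i k).
  rewrite -lee_fin fineK ?fin_num_measure // EFinD -PB EFinB -cdf_prob.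
  rewrite -probability_setC //; apply: le_trans (measureU2 _ _ _) => //.
    apply: le_measure; rewrite ?inE //.
    by apply: measurableU => //; exact: measurableC.
  exact: measurableC.
have le3 : psi S - psi (S + t) <= 1 - F i k.
  have := supported_increments (generator_supported psi_gen psi_ratio) (lexx 0) S0 t0.
  rewrite add0r psit (gen_at0 psi_gen); lra.
have le4 : psi (S + t) <= psi S.
  by apply: (generator_nonincreasing psi_gen) => //; rewrite lerDl.
rewrite ler_norml; lra.
Qed.

Lemma prob_second_largest_le :
  fine (P [set w | order_stat m.+1 (fun i => X i w) <= x]) = second_largest_cdf psi s.
Proof.
rewrite second_largest_le_bigcup.
rewrite (probability_bigcup_common_intersection P (A := [set w | forall j, X j w <= x])) //.
- rewrite prob_all_le /second_largest_cdf; congr (_ - _).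
  by apply: eq_bigr => i _; rewrite prob_all_but_one_le.
- have := measurable_all_le predT (fun=> x); congr (measurable _).
  by apply/seteqP; split=> w H j => [|_]; exact: H.
- by move=> i; exact: measurable_all_le.
- by move=> i w H j _; exact: H.
- move=> i j ij w [Hi Hj] k; have [->|ki] := eqVneq k i; last exact: Hi.
  exact: Hj.
Qed.
End Copula.

(** * Comparison of the second largest order statistics *)

Lemma cumulativeBounded_range (R : realType) (a b : R) (f : cumulativeBounded a b) x :
  a <= f x <= b.
Proof.
have fM := @cumulative_is_nondecreasing _ _ _ f.
apply/andP; split.
  apply: cvgr_to_le (@cumulativeNy _ _ _ f) _.
  by near=> y; apply: fM; near: y; apply: nbhs_ninfty_le; exact: num_real.
apply: cvgr_to_ge (@cumulativey _ _ _ f) _.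
by near=> y; apply: fM; near: y; apply: nbhs_pinfty_ge; exact: num_real.
Unshelve. all: end_near. Qed.

Theorem theorem3p12 (R : realType) (n : nat) (hn : (2 <= n)%N)
  (d1 : measure_display) (T1 : measurableType d1) (P : probability T1 R)
  (d2 : measure_display) (T2 : measurableType d2) (Q : probability T2 R)
  (X : 'I_n -> {RV P >-> R}) (Y : 'I_n -> {RV Q >-> R})
  (lambda theta alpha mu delta beta : 'I_n -> R)
  (lam th : R)
  (Fb : cumulativeBounded (0 : R) (1 : R)) (psi : R -> R)
  (hpsi : monotone_generator n psi)
  (hX : ELS X lambda theta alpha Fb psi)
  (hY : ELS Y mu delta beta Fb psi)
  (hlam : 0 < lam) (hth : 0 < th)
  (hlambda : lambda = fun=> lam) (hmu : mu = fun=> lam)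
  (htheta : theta = fun=> th) (hdelta : delta = fun=> th)
  (hab : (E_plus alpha /\ E_plus beta) \/ (D_plus alpha /\ D_plus beta))
  (hratio : increasing_gen_ratio psi)
  (hmaj : weak_supermajorizes beta alpha) :
  st_le Q P (fun w => order_stat n.-1 (fun i => Y i w))
            (fun w => order_stat n.-1 (fun i => X i w)).
Proof.
subst lambda mu theta delta.
case: n hn X Y alpha beta hpsi hX hY hab hmaj => [//|[//|m]] _ X Y alpha beta psi_gen.
move=> [_ _ alpha_gt0 _ _ X_cdf X_joint] [_ _ beta_gt0 _ _ Y_cdf Y_joint] _ hmaj x /=.
pose FX i := els_cdf Fb lam th (alpha i).
pose FY i := els_cdf Fb lam th (beta i).
have gtC (d : measure_display) (T : measurableType d) (Z : T -> R) :
    [set w | x < Z w] = ~` [set w | Z w <= x].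
  by apply/seteqP; split => w /=; rewrite ltNge => /negP.
have mX := measurable_second_largest_le X x.
have mY := measurable_second_largest_le Y x.
rewrite !gtC !probability_setC //.
rewrite leeB //.
set u := Fb ((x - lam) / th).
have /andP[u_ge0 u_le1] : 0 <= u <= 1 := cumulativeBounded_range Fb _.
(* Where the marginals vanish, X_(n-1:n) exceeds x almost surely. *)
have [F0|/andP[lamx u_gt0]] : (forall i, FX i x = 0) \/ (lam < x) && (0 < u).
  have [lamx|xlam] := boolP (lam < x); last first.
    by left=> i; rewrite /FX /els_cdf (negPf xlam).
  move: u_ge0; rewrite le_eqVlt => /predU1P[u0|]; last by right.
  by left=> i; rewrite /FX /els_cdf lamx -/u -u0 powR0 // gt_eqF.
  by rewrite (prob_second_largest_le_eq0 X_cdf F0).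
have FX_gt0 i : 0 < FX i x by rewrite /FX /els_cdf lamx powR_gt0.
have FY_gt0 i : 0 < FY i x by rewrite /FY /els_cdf lamx powR_gt0.
rewrite -(fineK (fin_num_measure P _ mX)) -(fineK (fin_num_measure Q _ mY)) lee_fin.
rewrite (prob_second_largest_le psi_gen hratio X_cdf X_joint FX_gt0).
rewrite (prob_second_largest_le psi_gen hratio Y_cdf Y_joint FY_gt0).
rewrite /els_cdf lamx -/u.
(* For u = 1 all marginals are 1, whatever the exponents. *)
move: u_le1; rewrite le_eqVlt => /predU1P[->|u_lt1]; first by rewrite powR1.
apply: (second_largest_cdf_le psi_gen hratio _ alpha_gt0 beta_gt0 hmaj).
by rewrite u_gt0.
Qed.
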